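(* Let $N\geq 1$. For a pair $(A,B)$ of orthogonal $N\times N$ Latin squares, let $\Gamma(A,B)=(C,\widetilde C)$, where $C=\{\sigma_1,\dots,\sigma_N\}$ and $\widetilde C=\{\omega_1,\dots,\omega_N\}$ are the enumerated (ordered) collections of permutations in $S_N$ defined by $$\sigma_j: A_{jk}\mapsto B_{jk}\quad\text{and}\quad \omega_j: A_{kj}\mapsto B_{kj}\qquad\text{for all } 1\leq j,k\leq N.$$ Then $\Gamma:(A,B)\mapsto (C,\widetilde C)$ is a bijection between the set of pairs $(A,B)$ of $N\times N$ orthogonal Latin squares and the set of pairs $(C,\widetilde C)$ of disconnected ordered maximal cliques in the derangement graph $X_N$.
   Context: An $N\times N$ Latin square is an $N\times N$ matrix in which each number $1,\dots,N$ appears exactly once in every row and every column. Two $N\times N$ Latin squares $A,B$ are orthogonal if the set of ordered pairs $\{(A_{ij},B_{ij}):1\leq i,j\leq N\}$ has exactly $N^2$ elements. A derangement is a permutation with no fixed points. The derangement graph $X_N$ is the undirected graph with vertex set $S_N$ (permutations of $\{1,\dots,N\}$), with an edge between $\sigma$ and $\tau$ if and only if $\sigma\tau^{-1}$ is a derangement. A clique is a set of vertices that are pairwise adjacent; it is maximal if it is not properly contained in another clique. (All maximal cliques of $X_N$ have exactly $N$ elements.) Two cliques $C,\widetilde C$ are disconnected if there is no edge between any vertex of $C$ and any vertex of $\widetilde C$. An ordered clique is a clique together with an enumeration of its members. Pairs are ordered pairs. *)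

(* Defs.v *)
From HB Require Import structures.
From mathcomp Require Import all_boot all_algebra all_fingroup.

Set Implicit Arguments.
Unset Strict Implicit.
Unset Printing Implicit Defensive.

(* Throughout, 'I_N stands for {1, ..., N}, both for the
   symbols and for the row and column indices. *)

Definition latin_square (N : nat) (A : 'M['I_N]_N) : bool :=
  [forall i, forall a, #|[set j | A i j == a]| == 1] &&
  [forall j, forall a, #|[set i | A i j == a]| == 1].

Definition orthogonal_squares (N : nat) (A B : 'M['I_N]_N) : bool :=
  #|[set (A i j, B i j) | i : 'I_N, j : 'I_N]| == N ^ 2.

Definition orthogonal_latin_pair (N : nat)
    (p : 'M['I_N]_N * 'M['I_N]_N) : bool :=
  [&& latin_square p.1, latin_square p.2 & orthogonal_squares p.1 p.2].

Definition derangement (N : nat) (s : 'S_N) : bool := [forall x, s x != x].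

(* MathComp's product of permutations is (s * t) x = t (s x), so the usual
   composite s o t^-1 is written t^-1 * s. *)
Definition derangement_graph (N : nat) : rel 'S_N :=
  fun s t => derangement (t^-1 * s)%g.

Definition clique (N : nat) (C : {set 'S_N}) : bool :=
  [forall s in C, forall t in C, (s != t) ==> derangement_graph s t].

Definition maximal_clique (N : nat) (C : {set 'S_N}) : bool :=
  maxset (@clique N) C.

(* The enumeration of a clique is a duplicate-free sequence of a priori
   arbitrary length. *)
Definition ordered_maximal_clique (N : nat) (c : seq 'S_N) : bool :=
  uniq c && maximal_clique [set s in c].

Definition disconnected (N : nat) (C D : {set 'S_N}) : bool :=
  [forall s in C, forall t in D, ~~ derangement_graph s t].

Definition disconnected_clique_pair (N : nat)
    (q : seq 'S_N * seq 'S_N) : bool :=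
  [&& ordered_maximal_clique q.1, ordered_maximal_clique q.2
    & disconnected [set s in q.1] [set t in q.2]].

(* The permutation mapping A j k to B j k for all k; the default value 1 is
   returned only if there is no such permutation, which does not happen for
   Latin squares. *)
Definition sigma (N : nat) (A B : 'M['I_N]_N) (j : 'I_N) : 'S_N :=
  odflt 1%g [pick s : 'S_N | [forall k, s (A j k) == B j k]].

Definition omega (N : nat) (A B : 'M['I_N]_N) (j : 'I_N) : 'S_N :=
  odflt 1%g [pick s : 'S_N | [forall k, s (A k j) == B k j]].

Definition Gamma (N : nat) (p : 'M['I_N]_N * 'M['I_N]_N) :
    seq 'S_N * seq 'S_N :=
  ([seq sigma p.1 p.2 j | j <- enum 'I_N],
   [seq omega p.1 p.2 j | j <- enum 'I_N]).

(* Main.v *)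
(* The squares are recovered from the cliques by taking [A i j] to be a point
   at which the [i]-th permutation of [C] and the [j]-th one of [C~] agree.
   Such a point exists because the cliques are disconnected, and it is unique
   when the cliques come from orthogonal squares. That a maximal clique has
   exactly [N] members is the extendability of Latin rectangles: a clique with
   fewer members leaves a regular bipartite graph of unused values, which has
   a perfect matching by Hall's theorem. *)
Require Import Defs.
From mathcomp Require Import all_boot all_algebra all_fingroup.
From mathcomp Require Import classical_sets functions.

Set Implicit Arguments.
Unset Strict Implicit.
Unset Printing Implicit Defensive.

(** * Hall's theorem and perfect matchings in regular bipartite graphs *)

Definition hall_condition (T U : finType) (F : T -> {set U}) : bool :=
  [forall S : {set T}, #|S| <= #|\bigcup_(x in S) F x|].

(* Rado's argument: in a minimal family satisfying Hall's condition, removing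
   either of two points from one [F x] breaks the condition on sets [A1], [A2];
   submodularity of cardinality rules out both at once. *)
Lemma hall_condition_remove (T U : finType) (F : T -> {set U}) (x : T)
    (y1 y2 : U) :
  hall_condition F -> y1 \in F x -> y2 \in F x -> y1 != y2 ->
  exists2 y, y \in F x &
    hall_condition (fun z => if z == x then F x :\ y else F z).
Proof.
move=> /forallP hallF Fy1 Fy2 y12.
pose G y z := if z == x then F x :\ y else F z.
have GF y (A : {set T}) : x \notin A ->
    \bigcup_(z in A) G y z = \bigcup_(z in A) F z.
  move=> xA; apply: eq_bigr => z zA; rewrite /G.
  by case: eqP zA xA => // -> ->.
case: (boolP (hall_condition (G y1))) => [h1|]; first by exists y1.
case: (boolP (hall_condition (G y2))) => [h2|]; first by exists y2.
rewrite !negb_forall => /existsP[S2] + /existsP[S1]; rewrite -!ltnNge.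
(* A set violating the condition for [G y] must contain [x], since elsewhere [G y] agrees with [F].
   Deleting [x] from it turns the strict inequality into a weak one. *)
have viol y (S : {set T}) : #|\bigcup_(z in S) G y z| < #|S| ->
    exists2 A : {set T}, x \notin A &
      #|(\bigcup_(z in A) F z) :|: (F x :\ y)| <= #|A|.
  move=> lt_S.
  case: (boolP (x \in S)) => xS; last first.
    by move: lt_S; rewrite (GF _ _ xS) ltnNge hallF.
  exists (S :\ x); first by rewrite !inE eqxx.
  move: lt_S; rewrite (big_setD1 x) //= GF ?inE ?eqxx //.
  by rewrite /G eqxx finset.setUC (cardsD1 x S) xS.
move=> /viol[A2 xA2 le2] /viol[A1 xA1 le1].
set P := _ :|: _ in le1; set Q := _ :|: _ in le2.
(* As [y1 != y2], the sets [F x :\ y1] and [F x :\ y2] together cover [F x], so Hall's condition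
   applies to the union with [x] added. This extra unit yields the contradiction once the bound for
   the intersection is added. *)
have leU : #|A1 :|: A2|.+1 <= #|P :|: Q|.
  have -> : #|A1 :|: A2|.+1 = #|x |: (A1 :|: A2)|.
    by rewrite cardsU1 inE negb_or xA1 xA2.
  apply: leq_trans (hallF _) _; apply/subset_leq_card/bigcupsP => z.
  rewrite !inE => /orP[/eqP->|/orP[zA|zA]]; apply/fintype.subsetP => u Fu.
  - rewrite !inE Fu !andbT; case: (eqVneq u y1) => [->|_]; last by rewrite orbT.
    by rewrite y12 !orbT.
  - by rewrite !inE; do 2 (apply/orP; left); apply/finset.bigcupP; exists z.
  - rewrite !inE; apply/orP; right; apply/orP; left.
    by apply/finset.bigcupP; exists z.
have leI : #|A1 :&: A2| <= #|P :&: Q|.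
  apply: leq_trans (hallF _) _; apply/subset_leq_card/bigcupsP => z.
  rewrite inE => /andP[zA1 zA2]; apply/fintype.subsetP => u Fu.
  rewrite !inE; apply/andP; split; apply/orP; left;
    by apply/finset.bigcupP; exists z.
have := leq_trans (leq_add leU leI) (eq_leq (cardsUI P Q)).
move=> /leq_trans/(_ (leq_add le1 le2)).
by rewrite addSn cardsUI ltnn.
Qed.

(** Induction on the total size of the family: points are removed as long as some [F x] has two of
    them. Once all sets are singletons, the choice is forced, and Hall's condition on pairs makes it
    injective. *)
Theorem hall (T U : finType) (F : T -> {set U}) :
  hall_condition F -> exists2 f : T -> U, injective f & forall x, f x \in F x.
Proof.
have [n] := ubnP (\sum_x #|F x|); elim: n F => // n IHn F /ltnSE leFn hallF.
have Fn0 x : exists y, y \in F x.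
  apply/set0Pn; rewrite -card_gt0.
  by have /forallP/(_ [set x]) := hallF; rewrite cards1 big_set1.
case: (boolP [exists x, 1 < #|F x|]) => [/existsP[x]|].
  move=> /card_gt1P[y1 [y2 [Fy1 Fy2 y12]]].
  have [y Fy hallG] := hall_condition_remove hallF Fy1 Fy2 y12.
  have [|f f_inj Gf] := IHn _ _ hallG; last first.
    exists f => // z; have := Gf z.
    by case: eqP => [->|//]; rewrite inE => /andP[].
  apply: leq_trans leFn; rewrite (bigD1 x) //= [X in _ < X](bigD1 x) //= eqxx.
  rewrite (cardsD1 y (F x)) Fy -addnS; apply: eq_leq.
  by rewrite addnS add1n; congr (_ + _).+1; apply: eq_bigr => z /negbTE->.
rewrite negb_exists => /forallP F1.
exists (fun x => xchoose (Fn0 x)) => [x1 x2 /= eq12|x]; last exact: xchooseP.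
(* If two singletons coincided, the union over [[set x1; x2]] would have only one element. *)
apply/eqP/negPn/negP => x12.
have /forallP/(_ [set x1; x2]) := hallF; rewrite cards2 x12.
rewrite leqNgt => /negP; apply.
have Fsub z : F z \subset [set xchoose (Fn0 z)].
  have /card_le1_eqP leF : #|F z| <= 1 by rewrite leqNgt F1.
  apply/fintype.subsetP => u Fu; rewrite inE; apply/eqP; apply: leF => //.
  exact: xchooseP.
rewrite -[X in _ < X.+1](cards1 (xchoose (Fn0 x1))) ltnS.
apply/subset_leq_card/bigcupsP => z.
by rewrite !inE => /orP[] /eqP->; [|rewrite eq12]; apply: Fsub.
Qed.

(** Hall's condition follows by double counting: exactly [k * #|S|] edges leave [S], all end in its
    neighbourhood [V], and only [k * #|V|] edges meet [V]. *)
Lemma regular_matching (T U : finType) (R : T -> U -> bool) (k : nat) :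
  0 < k -> (forall x, #|[set y | R x y]| = k) ->
  (forall y, #|[set x | R x y]| = k) ->
  exists2 f : T -> U, injective f & forall x, R x (f x).
Proof.
move=> k0 Rx Ry.
have [|f f_inj Rf] := @hall T U (fun x => [set y | R x y]); last first.
  by exists f => // x; have := Rf x; rewrite inE.
apply/forallP => S; set V := \bigcup_(x in S) _.
rewrite -(leq_pmul2r k0) -!sum_nat_const.
rewrite -(eq_bigr _ (fun x _ => Rx x)) -(eq_bigr _ (fun y _ => Ry y)).
under eq_bigr => x xS.
  have -> : [set y | R x y] = [set y in V | R x y].
    apply/setP => y; rewrite !inE; case Rxy: (R x y); rewrite ?andbF // andbT.
    by apply/esym/finset.bigcupP; exists x => //; rewrite inE.
  rewrite -sum1dep_card.
  over.
under [X in _ <= X]eq_bigr => y _ do rewrite -sum1dep_card.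
rewrite (exchange_big_dep (fun y => y \in V)) /=; last first.
  by move=> x y _ /andP[].
apply: leq_sum => y yV; rewrite [X in _ <= X](bigID (fun x => x \in S)) /=.
rewrite (eq_bigl (fun x => R x y && (x \in S))) ?leq_addr // => x.
by rewrite yV andbC.
Qed.

(** * Cliques of the derangement graph and their size *)

Lemma derangement_graphP (N : nat) (s t : 'S_N) :
  reflect (forall x, s x != t x) (derangement_graph s t).
Proof.
apply: (iffP forallP) => st x.
  by have := st (t x); rewrite permM permK.
by rewrite permM -{2}(permKV t x) st.
Qed.

(** Adjacent permutations agree nowhere. Hence the members of a clique take [#|C|] distinct values
    at each point, which drives the counts below. *)
Lemma clique_inj (N : nat) (C : {set 'S_N}) (x : 'I_N) :
  clique C -> {in C &, injective (fun s : 'S_N => s x)}.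
Proof.
move=> /forall_inP cC s t sC tC /= eq_st; apply/eqP/negPn/negP => st.
have /forall_inP/(_ t tC) := cC s sC.
by rewrite st => /derangement_graphP/(_ x); rewrite eq_st eqxx.
Qed.

Lemma clique_card_le (N : nat) (C : {set 'S_N}) :
  0 < N -> clique C -> #|C| <= N.
Proof.
move=> N0 cC; rewrite -(card_in_imset (clique_inj (x := Ordinal N0) cC)).
by rewrite -[X in _ <= X]card_ord max_card.
Qed.

(** Join [x] to [y] when no member of [C] sends [x] to [y]. This bipartite graph is regular of
    degree [N - #|C|], and a perfect matching in it is a permutation that differs from every member
    everywhere. *)
Lemma clique_extend (N : nat) (C : {set 'S_N}) :
  clique C -> #|C| < N ->
  exists2 s, s \notin C & clique (s |: C).
Proof.
move=> cC ltCN.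
have card_out x : #|[set y | [forall s in C, s x != y]]| = N - #|C|.
  rewrite -(card_in_imset (clique_inj (x := x) cC)) -[X in X - _]card_ord
    -[_ @: _]finset.setCK -cardsCs; congr #|pred_of_set _|.
  apply/setP => y; rewrite !inE.
  apply/forall_inP/negP => [h /imsetP[s sC y_s]|h s sC].
    by have := h s sC; rewrite y_s eqxx.
  by apply/eqP => sxy; apply: h; apply/imsetP; exists s.
have card_in y : #|[set x | [forall s in C, s x != y]]| = N - #|C|.
  (* The points excluded for [y] are the preimages of [y]. Two members sharing such a preimage would
     agree there, so these points are distinct. *)
  have inv_inj : {in C &, injective (fun s : 'S_N => (s^-1)%g y)}.
    move=> s t sC tC /= eq_st; apply: (clique_inj (x := (s^-1)%g y) cC) => //=.
    by rewrite {2}eq_st !permKV.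
  rewrite -(card_in_imset inv_inj) -[X in X - _]card_ord
    -[_ @: _]finset.setCK -cardsCs; congr #|pred_of_set _|.
  apply/setP => x; rewrite !inE.
  apply/forall_inP/negP => [h /imsetP[s sC x_s]|h s sC].
    by have := h s sC; rewrite x_s permKV eqxx.
  by apply/eqP => sxy; apply: h; apply/imsetP; exists s; rewrite // -sxy permK.
have [|f f_inj Cf] := regular_matching _ card_out card_in.
  by rewrite subn_gt0.
have fC s x : s \in C -> s x != perm f_inj x.
  by move=> sC; rewrite permE; have /forall_inP/(_ s sC) := Cf x.
exists (perm f_inj).
  (* A point at which to compare exists because [#|C| < N] forces [N] to be positive. *)
  apply/negP => /fC fC'; have := fC' (Ordinal (leq_ltn_trans (leq0n _) ltCN)).
  by rewrite eqxx.
apply/forall_inP => s; rewrite !inE => sC.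
apply/forall_inP => t; rewrite !inE => tC.
apply/implyP => st; apply/derangement_graphP => x.
case/orP: sC st => [/eqP->|sC]; case/orP: tC => [/eqP->|tC] st.
- by rewrite eqxx in st.
- by rewrite eq_sym fC.
- exact: fC.
- by apply: contraNneq st => /(clique_inj cC sC tC) ->.
Qed.

Lemma maximal_cliqueE (N : nat) (C : {set 'S_N}) :
  0 < N -> maximal_clique C = clique C && (#|C| == N).
Proof.
move=> N0; apply/maxsetP/andP => [[cC maxC]|[cC /eqP cardC]]; split=> //.
- rewrite eqn_leq clique_card_le //= leqNgt; apply/negP => ltCN.
  have [s sC cSC] := clique_extend cC ltCN.
  by rewrite -(maxC _ cSC (finset.subsetUr _ _)) setU11 in sC.
- move=> D cD sCD; apply/eqP; rewrite eq_sym eqEcard sCD cardC.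
  exact: clique_card_le.
Qed.

(** Distinctness of the entries and their adjacency merge into one condition on positions. It serves
    both to check that [Gamma] yields cliques and to separate indices when the squares are
    rebuilt. *)
Lemma ordered_maximal_cliqueP (N : nat) (c : seq 'S_N) : 0 < N ->
  reflect (size c = N /\
           forall (i j x : 'I_N), nth 1%g c i x = nth 1%g c j x -> i = j)
          (ordered_maximal_clique c).
Proof.
move=> N0; rewrite /ordered_maximal_clique maximal_cliqueE // cardsE.
apply: (iffP and3P) => [[uc cc /eqP]|[sz_c inj_c]].
  rewrite (card_uniqP uc) => sz_c; split=> // i j x eq_ij.
  have mem_c (k : 'I_N) : nth 1%g c k \in [set s in c].
    by rewrite inE mem_nth ?sz_c.
  have /eqP := clique_inj cc (mem_c i) (mem_c j) eq_ij.
  by rewrite nth_uniq ?sz_c // => /eqP/val_inj.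
have uc : uniq c.
  apply/(uniqP 1%g) => i j; rewrite !inE sz_c => ltiN ltjN eq_ij.
  have := inj_c (Ordinal ltiN) (Ordinal ltjN) (Ordinal N0).
  by rewrite /= eq_ij => /(_ erefl)[].
split=> //; last by rewrite (card_uniqP uc) sz_c.
apply/forall_inP => s; rewrite inE => /(nthP 1%g)[i + <-]; rewrite sz_c => ltiN.
apply/forall_inP => t; rewrite inE => /(nthP 1%g)[j + <-]; rewrite sz_c => ltjN.
apply/implyP => ne_ij; apply/derangement_graphP => x.
apply: contraNneq ne_ij => /(inj_c (Ordinal ltiN) (Ordinal ltjN))[->].
by [].
Qed.

Lemma disconnectedP (N : nat) (c d : seq 'S_N) : size c = N -> size d = N ->
  reflect (forall i j : 'I_N, exists x, nth 1%g c i x = nth 1%g d j x)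
          (disconnected [set s in c] [set t in d]).
Proof.
move=> sz_c sz_d; apply: (iffP forall_inP) => [dcd i j|dcd s].
  have ci : nth 1%g c i \in [set s in c] by rewrite inE mem_nth ?sz_c.
  have dj : nth 1%g d j \in [set t in d] by rewrite inE mem_nth ?sz_d.
  have /forall_inP/(_ _ dj) := dcd _ ci.
  rewrite negb_forall => /existsP[x]; rewrite negbK permM => /eqP eq_x.
  (* A fixed point [x] of the composite of one permutation with the inverse of the other gives
     agreement at the preimage of [x], not at [x] itself. *)
  by exists ((nth 1%g d j)^-1 x)%g; rewrite eq_x permKV.
rewrite inE => /(nthP 1%g)[i + <-]; rewrite sz_c => ltiN.
apply/forall_inP => t; rewrite inE => /(nthP 1%g)[j + <-]; rewrite sz_d => ltjN.
have [x eq_x] := dcd (Ordinal ltiN) (Ordinal ltjN).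
by apply/negP => /derangement_graphP/(_ x); rewrite eq_x eqxx.
Qed.

(** * Latin squares and orthogonality as injectivity conditions *)

Lemma inj_fiber_card1 (N : nat) (f : 'I_N -> 'I_N) :
  reflect (injective f) [forall a, #|[set j | f j == a]| == 1].
Proof.
apply: (iffP forallP) => [f1 i j eq_ij|f_inj a].
  have /cards1P[k fk] := f1 (f j).
  have /set1P-> : i \in [set k] by rewrite -fk inE eq_ij.
  by apply/esym/set1P; rewrite -fk inE.
apply/cards1P; exists (invF f_inj a); apply/setP => j.
by rewrite !inE (can2_eq (invF_f f_inj) (f_invF f_inj)).
Qed.

Lemma latin_squareP (N : nat) (A : 'M['I_N]_N) :
  reflect ((forall i, injective (A i)) /\ (forall j, injective (A^~ j)))
          (latin_square A).
Proof.
apply: (iffP andP) => -[hr hc]; split.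
- by move=> i; apply/inj_fiber_card1; apply: (forallP hr).
- by move=> j; apply/(inj_fiber_card1 (A^~ j)); apply: (forallP hc).
- by apply/forallP => i; apply/inj_fiber_card1.
- by apply/forallP => j; apply/(inj_fiber_card1 (A^~ j)).
Qed.

Lemma orthogonal_squaresP (N : nat) (A B : 'M['I_N]_N) :
  reflect (forall i j i' j', A i j = A i' j' -> B i j = B i' j' ->
             i = i' /\ j = j')
          (orthogonal_squares A B).
Proof.
pose f (u : 'I_N * 'I_N) := (A u.1 u.2, B u.1 u.2).
have -> : orthogonal_squares A B = (#|f @: [set: 'I_N * 'I_N]| ==
                                      #|[set: 'I_N * 'I_N]|).
  rewrite /orthogonal_squares cardsT card_prod card_ord -mulnn.
  congr (#|pred_of_set _| == _); apply/setP => y.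
  apply/imset2P/imsetP => [[i j _ _ ->]|[[i j] _ ->]].
    by exists (i, j); rewrite ?inE.
  by exists i j.
apply: (iffP imset_injP) => [f_inj i j i' j' eqA eqB|h [i j] [i' j'] _ _].
  have := f_inj (i, j) (i', j') (finset.in_setT _) (finset.in_setT _).
  by rewrite /f /= eqA eqB => /(_ erefl)[].
by rewrite /f /= => -[eqA eqB]; have [-> ->] := h _ _ _ _ eqA eqB.
Qed.

Lemma perm_interpolation (N : nat) (f g : 'I_N -> 'I_N) :
  injective f -> injective g ->
  forall k, odflt 1%g [pick s : 'S_N | [forall k, s (f k) == g k]] (f k) = g k.
Proof.
move=> f_inj g_inj k; case: pickP => [s /forallP/(_ k)/eqP //|no_s].
(* The inverse of [f] followed by [g] is a witness, so the default value is never reached. *)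
have /forallP[] := negbT (no_s ((perm f_inj)^-1 * perm g_inj)%g) => k'.
by rewrite permM -{1}(permE f_inj) permK permE.
Qed.

Lemma nth_map_enum_ord (N : nat) (T : Type) (x0 : T) (F : 'I_N -> T)
    (i : 'I_N) :
  nth x0 [seq F j | j <- enum 'I_N] i = F i.
Proof. by rewrite (nth_map i) ?size_enum_ord // nth_ord_enum. Qed.

Lemma eq_map_enum_ord (N : nat) (T : Type) (x0 : T) (F : 'I_N -> T)
    (c : seq T) :
  size c = N -> (forall i : 'I_N, F i = nth x0 c i) ->
  [seq F j | j <- enum 'I_N] = c.
Proof.
move=> sz_c eqF; apply: (@eq_from_nth _ x0).
  by rewrite size_map size_enum_ord.
rewrite size_map size_enum_ord => i ltiN.
by rewrite (nth_map_enum_ord x0 F (Ordinal ltiN)) eqF.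
Qed.

(** * From orthogonal squares to disconnected cliques *)

Section OrthogonalPair.

Variables (N : nat) (A B : 'M['I_N]_N).
Hypothesis AB : orthogonal_latin_pair (A, B).

Lemma sigmaE (j k : 'I_N) : sigma A B j (A j k) = B j k.
Proof.
have [/latin_squareP[A_row _] /latin_squareP[B_row _] _] := and3P AB.
exact: perm_interpolation.
Qed.

Lemma omegaE (j k : 'I_N) : omega A B j (A k j) = B k j.
Proof.
have [/latin_squareP[_ A_col] /latin_squareP[_ B_col] _] := and3P AB.
exact: (perm_interpolation (A_col j) (B_col j)).
Qed.

Lemma row_surj (i y : 'I_N) : exists k, y = A i k.
Proof.
have [/latin_squareP[A_row _] _ _] := and3P AB.
by exists (invF (A_row i) y); rewrite f_invF.
Qed.

Lemma col_surj (j y : 'I_N) : exists k, y = A k j.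
Proof.
have [/latin_squareP[_ A_col] _ _] := and3P AB.
by exists (invF (A_col j) y); rewrite (f_invF (A_col j)).
Qed.

(** The symbol [y] occurs in row [i] and in column [j]. If the two permutations agree at [y], these
    two cells carry the same pair of symbols, so by orthogonality both are the cell [(i, j)]. This
    determines [A] from the cliques. *)
Lemma sigma_omega_agree (i j y : 'I_N) :
  sigma A B i y = omega A B j y -> y = A i j.
Proof.
have [_ _ /orthogonal_squaresP orthAB] := and3P AB.
have [k eq_ik] := row_surj i y; have [l eq_lj] := col_surj j y.
rewrite {1}eq_ik sigmaE eq_lj omegaE => eqB.
have [] := orthAB _ _ _ _ (etrans (esym eq_ik) eq_lj) eqB.
by move=> ->.
Qed.

Lemma sigma_sep (i j y : 'I_N) : sigma A B i y = sigma A B j y -> i = j.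
Proof.
have [_ _ /orthogonal_squaresP orthAB] := and3P AB.
have [k eq_ik] := row_surj i y; have [l eq_jl] := row_surj j y.
rewrite {1}eq_ik sigmaE eq_jl sigmaE => eqB.
by have [] := orthAB _ _ _ _ (etrans (esym eq_ik) eq_jl) eqB.
Qed.

Lemma omega_sep (i j y : 'I_N) : omega A B i y = omega A B j y -> i = j.
Proof.
have [_ _ /orthogonal_squaresP orthAB] := and3P AB.
have [k eq_ki] := col_surj i y; have [l eq_lj] := col_surj j y.
rewrite {1}eq_ki omegaE eq_lj omegaE => eqB.
by have [] := orthAB _ _ _ _ (etrans (esym eq_ki) eq_lj) eqB.
Qed.

Lemma Gamma_disconnected_clique_pair :
  0 < N -> disconnected_clique_pair (Gamma (A, B)).
Proof.
move=> N0; apply/and3P; split => /=.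
- apply/ordered_maximal_cliqueP => //; split.
    by rewrite size_map size_enum_ord.
  by move=> i j x; rewrite !nth_map_enum_ord; apply: sigma_sep.
- apply/ordered_maximal_cliqueP => //; split.
    by rewrite size_map size_enum_ord.
  by move=> i j x; rewrite !nth_map_enum_ord; apply: omega_sep.
- apply/disconnectedP => [||i j]; [by rewrite size_map size_enum_ord..|].
  by exists (A i j); rewrite !nth_map_enum_ord sigmaE omegaE.
Qed.

End OrthogonalPair.

(** * Injectivity and surjectivity of [Gamma] *)

Lemma Gamma_inj (N : nat) (A B A' B' : 'M['I_N]_N) :
  orthogonal_latin_pair (A, B) -> orthogonal_latin_pair (A', B') ->
  Gamma (A, B) = Gamma (A', B') -> (A, B) = (A', B').
Proof.
move=> AB AB' [eq_s eq_o].
have eq_si i : sigma A B i = sigma A' B' i.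
  by rewrite -(nth_map_enum_ord 1%g (sigma A B)) eq_s nth_map_enum_ord.
have eq_oi i : omega A B i = omega A' B' i.
  by rewrite -(nth_map_enum_ord 1%g (omega A B)) eq_o nth_map_enum_ord.
have eqA i j : A i j = A' i j.
  by apply: (sigma_omega_agree AB'); rewrite -eq_si -eq_oi sigmaE ?omegaE.
congr (_, _); apply/matrixP => i j //.
by rewrite -(sigmaE AB) -(sigmaE AB') eq_si eqA.
Qed.

Lemma Gamma_surj (N : nat) (c d : seq 'S_N) :
  0 < N -> disconnected_clique_pair (c, d) ->
  exists2 p : 'M['I_N]_N * 'M['I_N]_N,
    orthogonal_latin_pair p & Gamma p = (c, d).
Proof.
move=> N0 /and3P[/= /(ordered_maximal_cliqueP _ N0)[sz_c c_sep]].
move=> /(ordered_maximal_cliqueP _ N0)[sz_d d_sep].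
move=> /(disconnectedP sz_c sz_d) cd.
have cd' (i j : 'I_N) : exists x, nth 1%g c i x == nth 1%g d j x.
  by have [x eq_x] := cd i j; exists x; apply/eqP.
pose A : 'M['I_N]_N := (\matrix_(i, j) xchoose (cd' i j))%R.
pose B : 'M['I_N]_N := (\matrix_(i, j) nth 1%g c i (A i j))%R.
have BcE i j : B i j = nth 1%g c i (A i j) by rewrite mxE.
(* At the chosen point both families give the same value, so [B] can be read through [c] by rows or
   through [d] by columns. The remaining checks switch between these two readings. *)
have BdE i j : B i j = nth 1%g d j (A i j).
  by rewrite BcE [A i j]mxE; apply/eqP/(xchooseP (cd' i j)).
(* A repeated entry in row [i] of [A] is a point where two members of [d] both agree with the [i]-th
   member of [c], hence with each other. *)
have A_row i : injective (A i).
  move=> j j' eqA; apply: (d_sep _ _ (A i j)).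
  by rewrite -BdE eqA -BdE !BcE eqA.
have A_col j : injective (A^~ j).
  move=> i i' /= eqA; apply: (c_sep _ _ (A i j)).
  by rewrite -BcE eqA -BcE !BdE eqA.
have AB : orthogonal_latin_pair (A, B).
  apply/and3P; split; rewrite /=.
  - exact/latin_squareP.
  - apply/latin_squareP; split=> [i j j'|j i i'] /=.
      by rewrite !BcE => /perm_inj/A_row.
    by rewrite !BdE => /perm_inj/A_col.
  (* Equal pairs of symbols mean that the members of [c] at [i] and [i'] agree at a point, as do the
     members of [d] at [j] and [j']. *)
  - apply/orthogonal_squaresP => i j i' j' eqA eqB.
    split; [apply: (c_sep _ _ (A i j)) | apply: (d_sep _ _ (A i j))].
      by rewrite -BcE eqA -BcE.
    by rewrite -BdE eqA -BdE.
exists (A, B) => //; rewrite /Gamma /=.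
rewrite (eq_map_enum_ord (x0 := 1%g) (F := sigma A B) sz_c) => [|i].
  rewrite (eq_map_enum_ord (x0 := 1%g) (F := omega A B) sz_d) // => i.
  by apply/permP => y; have [k ->] := col_surj AB i y; rewrite omegaE // BdE.
by apply/permP => y; have [k ->] := row_surj AB i y; rewrite sigmaE // BcE.
Qed.

Theorem theorem2p4 (N : nat) (hN : 0 < N) :
  (forall A B : 'M['I_N]_N, orthogonal_latin_pair (A, B) ->
     forall j k : 'I_N,
       sigma A B j (A j k) = B j k /\ omega A B j (A k j) = B k j) /\
  set_bij [set p : 'M['I_N]_N * 'M['I_N]_N | orthogonal_latin_pair p]%classic
          [set q : seq 'S_N * seq 'S_N | disconnected_clique_pair q]%classic
          (@Gamma N).
Proof.
split=> [A B AB j k|]; first by rewrite sigmaE // omegaE.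
split.
- by move=> [A B] /= AB; apply: Gamma_disconnected_clique_pair.
- move=> [A B] [A' B']; rewrite !in_setE /=; exact: Gamma_inj.
- by move=> [c d] /= /(Gamma_surj hN)[p AB eq_p]; exists p.
Qed.
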